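(* Fix an integer $k\ge 3$ and let $n\ge k$. Let the edges of the complete graph $K_n$ be given independent uniform $[0,1]$ edge weights, and let $W$ denote the minimum weight of a clique $K_k$ in $K_n$. For $z\ge 0$ let $$w=\frac{z}{n^{2/(k-1)}}\qquad\text{and}\qquad \lambda=\binom{n}{k}\frac{w^{\binom k2}}{\binom k2!}$$ (so that $\lambda\sim \frac{z^{\binom k2}}{k!\,\binom k2!}$ as $n\to\infty$). Put $m=\binom k2$, $p=\frac{w^m}{m!}$, and for $2\le \ell\le k$ put $u_\ell=\binom{k}{\ell}\binom{n-k}{k-\ell}$ and $m_\ell=\binom k2-\binom \ell2$, and let $$b_1=\binom nk\sum_{\ell=2}^{k}u_\ell\,p^2,\qquad b_2=\binom nk\sum_{\ell=2}^{k-1}u_\ell\,\frac{w^{m+m_\ell}}{(m+m_\ell)!}\binom{2m_\ell}{m_\ell}.$$ Then, for $z\le n^{2/(k-1)}$ (equivalently, $w\le 1$), $$\left|\Pr\left(W\ge w=\frac{z}{n^{2/(k-1)}}\right)-\exp(-\lambda)\right|\le b_1+b_2.$$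
   Context: The weight of a clique is the sum of the weights of its edges. $\binom k2!$ means $\left(\binom k2\right)!$. $f\sim g$ means $f/g\to1$ as $n\to\infty$. A binomial coefficient $\binom{N}{r}$ with $0\le N<r$ is $0$. *)

(* Defs.v *)
From mathcomp Require Import all_boot all_order all_algebra.
From mathcomp Require Import all_classical all_reals all_analysis.

Set Implicit Arguments.
Unset Strict Implicit.
Unset Printing Implicit Defensive.

Import Order.TTheory GRing.Theory Num.Theory.
Import numFieldNormedType.Exports.

Local Open Scope classical_set_scope.
Local Open Scope ring_scope.

Definition edge (n : nat) := {e : {set 'I_n} | #|e| == 2%N}.

Section RandomWeights.
Context d (T : measurableType d) (R : realType) (P : probability T R).

Definition mutually_independent (I : finType) (X : I -> {RV P >-> R}) : Prop :=
  forall (J : {set I}) (A : I -> set R), (forall i, measurable (A i)) ->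
    P (\bigcap_(i in [set` J]) (X i @^-1` A i)) =
    (\prod_(i in J) P (X i @^-1` A i))%E.

Definition uniform01 (X : {RV P >-> R}) : Prop :=
  forall A : set R, measurable A ->
    distribution P X A = uniform_prob (@ltr01 R) A.

Definition clique_weight (n : nat) (X : edge n -> {RV P >-> R})
    (S : {set 'I_n}) (t : T) : R :=
  \sum_(e : edge n | sval e \subset S) X e t.

(* The value is in \bar R only so that the minimum has a neutral element: it is
   +oo exactly when n < k, and a genuine minimum of reals otherwise. *)
Definition min_clique_weight (n k : nat) (X : edge n -> {RV P >-> R})
    (t : T) : \bar R :=
  \big[Order.min/+oo%E]_(S : {set 'I_n} | #|S| == k) (clique_weight X S t)%:E.

End RandomWeights.

Section Bounds.
Context (R : realType) (k n : nat).

Definition threshold (z : R) : R := z / n%:R `^ (2 / (k - 1)%:R).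

Definition clique_prob (w : R) : R := w ^+ 'C(k, 2) / ('C(k, 2)`!)%:R.

Definition lambda (w : R) : R :=
  'C(n, k)%:R * (w ^+ 'C(k, 2) / ('C(k, 2)`!)%:R).

(* Number of k-cliques meeting a given k-clique in exactly l vertices. *)
Definition nb_overlap (l : nat) : nat := ('C(k, l) * 'C(n - k, k - l))%N.

(* Number of edges of such a k-clique lying outside the given one. *)
Definition nb_new_edges (l : nat) : nat := ('C(k, 2) - 'C(l, 2))%N.

Definition b1 (w : R) : R :=
  'C(n, k)%:R * \sum_(2 <= l < k.+1) (nb_overlap l)%:R * clique_prob w ^+ 2.

Definition b2 (w : R) : R :=
  'C(n, k)%:R * \sum_(2 <= l < k)
    (nb_overlap l)%:R
    * (w ^+ ('C(k, 2) + nb_new_edges l) / (('C(k, 2) + nb_new_edges l)`!)%:R)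
    * 'C(2 * nb_new_edges l, nb_new_edges l)%:R.

End Bounds.

(* Main.v *)
(* The number [W] of cliques of weight below [w] is a sum of locally dependent
   indicators: cliques sharing no edge depend on disjoint families of weights.
   For [h s = exp (- lambda s) * E (s ^ W)], one has [h 0 = P (W = 0)] and
   [h 1 = exp (- lambda)], while on [0, 1] the derivative
   [exp (- lambda s) * (E (W s ^ (W - 1)) - lambda E (s ^ W))] is bounded by
   [b1 + b2]: in the term of a clique, replace [W] by the number of light cliques
   sharing no edge with it, which is independent of it, and use
   [|s ^ a - s ^ b| <= |a - b|]. The mean value theorem concludes.
   The probabilities in [b1] and [b2] come from a single recursion: if
   [P (M < x) = c x ^ a / a!] for [x <= 1] and [U] is uniform and independent of
   [M], then [P (U + M < x) = c x ^ (a + 1) / (a + 1)!]. A pair of cliques starts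
   from [M = max (Z, Z')], where [Z] and [Z'] are the independent weights of the
   edges that belong to only one of them. *)
Require Import Defs.
From mathcomp Require Import all_boot all_order all_algebra.
From mathcomp Require Import all_classical all_reals all_analysis.
From mathcomp Require Import measurable_realfun ring zify.
Import Order.TTheory GRing.Theory Num.Theory.
Import numFieldNormedType.Exports.
Local Open Scope classical_set_scope.
Local Open Scope ring_scope.
Set Implicit Arguments.
Unset Strict Implicit.

(** * Poisson approximation on a finite probability space *)

Section FinitePoissonApproximation.
Context (R : realType) (I : finType) (q : {set I} -> R) (N : I -> {set I}).

(** [q] is the law of a random subset of [I], the set of indices that occur, and [N i] is the
    dependency neighbourhood of [i]. *)
Definition occ_prob i : R := \sum_(A : {set I} | i \in A) q A.
Definition cooc_prob i j : R := \sum_(A : {set I} | (i \in A) && (j \in A)) q A.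
Let far i (A : {set I}) := (A :\: N i)%SET.

Lemma expr_sub_le (s : R) (a b : nat) : 0 <= s <= 1 -> (a <= b)%N ->
  `|s ^+ a - s ^+ b| <= (b - a)%:R.
Proof.
move=> /andP[s0 s1] ab; rewrite ger0_norm; last by rewrite subr_ge0 ler_wiXn2l.
have [->|ba] := eqVneq a b; first by rewrite subrr subnn.
apply: (@le_trans _ _ 1); last by rewrite ler1n subn_gt0 ltn_neqAle ba.
by rewrite lerBlDr ler_wpDr ?exprn_ge0// exprn_ile1.
Qed.

Hypothesis q_ge0 : forall A, 0 <= q A.
Hypothesis q_sum1 : \sum_(A : {set I}) q A = 1.
Hypothesis self_near : forall i, i \in N i.
Hypothesis far_indep : forall i C,
  \sum_(A : {set I} | (i \in A) && (far i A == C)) q A =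
  occ_prob i * \sum_(A : {set I} | far i A == C) q A.

(** Probability generating function of the number of occurring indices. *)
Let gen : {poly R} := \sum_(A : {set I}) q A *: 'X^#|A|.

Let sum_card_near (S : {set I}) (Q : pred {set I}) :
  \sum_(A | Q A) q A * #|(A :&: S)%SET|%:R =
  \sum_(j in S) \sum_(A | Q A && (j \in A)) q A.
Proof.
under [RHS]eq_bigr do rewrite big_mkcondr.
rewrite exchange_big; apply: eq_bigr => A _ /=.
rewrite -big_mkcondr sumr_const mulr_natr; congr (_ *+ _).
by apply: eq_card => j; rewrite !inE andbC.
Qed.

(** The power depends on [A] only through its part outside [N i], so grouping the sets [A] by that
    part reduces the claim to [far_indep]. *)
Let indep_pow (s : R) i : \sum_(A : {set I} | i \in A) q A * s ^+ #|far i A| =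
  occ_prob i * \sum_A q A * s ^+ #|far i A|.
Proof.
rewrite (partition_big (far i) xpredT)//=.
rewrite [in RHS](partition_big (far i) xpredT)//=.
rewrite mulr_sumr; apply: eq_bigr => C _.
under eq_bigr => A /andP[_ /eqP ->] do [].
under [in RHS]eq_bigr => A /eqP -> do [].
by rewrite -!mulr_suml far_indep mulrA.
Qed.

Let stein_bound (s : R) : 0 <= s <= 1 ->
  `|gen^`().[s] - (\sum_i occ_prob i) * gen.[s]| <=
  \sum_i \sum_(j in N i) occ_prob i * occ_prob j +
  \sum_i \sum_(j in N i | j != i) cooc_prob i j.
Proof.
move=> s01.
have -> : gen^`().[s] = \sum_i \sum_(A : {set I} | i \in A) q A * s ^+ #|A|.-1.
  rewrite /gen raddf_sum horner_sum.
  under [RHS]eq_bigr do rewrite big_mkcond.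
  rewrite exchange_big; apply: eq_bigr => A _ /=.
  rewrite -big_mkcond sumr_const derivZ derivXn hornerZ hornerMn hornerXn.
  by rewrite mulrnAr.
have -> : gen.[s] = \sum_A q A * s ^+ #|A|.
  by rewrite horner_sum; apply: eq_bigr => A _; rewrite hornerZ hornerXn.
rewrite mulr_suml -sumrB -big_split/=.
apply: (le_trans (ler_norm_sum _ _ _)); apply: ler_sum => i _.
(* Add and subtract the terms with exponent [#|far i A|]: by [indep_pow] they cancel, and two
   replacement errors remain, one for each double sum of the bound. *)
have -> : \sum_(A : {set I} | i \in A) q A * s ^+ #|A|.-1 -
    occ_prob i * \sum_A q A * s ^+ #|A| =
  occ_prob i * (\sum_A q A * (s ^+ #|far i A| - s ^+ #|A|)) -
    \sum_(A : {set I} | i \in A) q A * (s ^+ #|far i A| - s ^+ #|A|.-1).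
  rewrite (eq_bigr _ (fun A _ => mulrBr (q A) _ _)) sumrB.
  rewrite [X in _ = _ - X](eq_bigr _ (fun A _ => mulrBr (q A) _ _)) sumrB.
  by rewrite indep_pow; ring.
apply: (le_trans (ler_normB _ _)).
have cfar (A : {set I}) : (#|A| - #|far i A|)%N = #|A :&: N i|%SET.
  by rewrite -(cardsID (N i) A) addnK.
have p0 j : 0 <= occ_prob j by apply: sumr_ge0.
apply: lerD.
  rewrite normrM ger0_norm// -mulr_sumr; apply: ler_wpM2l => //.
  apply: (le_trans (ler_norm_sum _ _ _)).
  rewrite -(sum_card_near (N i) xpredT); apply: ler_sum => A _.
  rewrite normrM ger0_norm//; apply: ler_wpM2l => //.
  by rewrite -cfar; apply: expr_sub_le => //; rewrite subset_leq_card// subsetDl.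
apply: (le_trans (ler_norm_sum _ _ _)).
have -> : \sum_(j in N i | j != i) cooc_prob i j =
    \sum_(j in (N i :\ i)%SET) cooc_prob i j.
  by apply: eq_bigl => j; rewrite !inE andbC.
rewrite -(sum_card_near _ (fun A => i \in A)); apply: ler_sum => A iA.
rewrite normrM ger0_norm//; apply: ler_wpM2l => //.
have -> : (A :&: (N i :\ i) = (A :&: N i) :\ i)%SET.
  by apply/setP => j; rewrite !inE andbCA.
(* Here [i] lies in both [A] and [N i]. Removing it from [A :&: N i] matches the exponent [#|A|.-1],
   whence the restriction [j != i] in the second double sum. *)
have e1 := cardsD1 i (A :&: N i)%SET.
rewrite !inE iA self_near/= in e1.
have e2 := cardsID (N i) A; rewrite -/(far i A) in e2.
have -> : #|((A :&: N i) :\ i)%SET| = (#|A|.-1 - #|far i A|)%N by lia.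
by apply: expr_sub_le => //; lia.
Qed.

Lemma poisson_approximation :
  `|q finset.set0 - expR (- \sum_i occ_prob i)| <=
  \sum_i \sum_(j in N i) occ_prob i * occ_prob j +
  \sum_i \sum_(j in N i | j != i) cooc_prob i j.
Proof.
set lam := \sum_i occ_prob i.
pose h (s : R) := expR (- lam * s) * gen.[s].
pose dh (s : R) := expR (- lam * s) * (gen^`().[s] - lam * gen.[s]).
have lam0 : 0 <= lam by apply: sumr_ge0 => i _; apply: sumr_ge0.
have hdh (s : R) : is_derive s (1 : R) h (dh s).
  have dlin : is_derive s (1 : R) (fun x : R => - lam * x) (- lam).
    have dZ := is_deriveZ (- lam) (is_derive_id s (1 : R)).
    by apply: (is_derive_eq dZ); exact: mulr1.
  have dexp := @is_derive1_comp _ expR _ s _ _ (is_derive_expR _) dlin.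
  have dh' := is_deriveM dexp (is_derive_poly gen s).
  by apply: (is_derive_eq dh'); rewrite /dh /GRing.scale/=; ring.
have hc : {within `[0, 1], continuous h}.
  apply: derivable_within_continuous => s _; exact: ex_derive.
have [c c01] := MVT_segment ler01 (fun x _ => hdh x) hc.
rewrite /h !mulr0 expR0 mul1r mulr1 subr0 mulr1.
have -> : gen.[0] = q finset.set0.
  rewrite horner_sum (bigD1 finset.set0)//= big1 ?addr0.
    by rewrite hornerZ hornerXn cards0 expr0 mulr1.
  by move=> A A0; rewrite hornerZ hornerXn expr0n cards_eq0 (negbTE A0) mulr0.
have -> : gen.[1] = 1.
  rewrite horner_sum -[RHS]q_sum1; apply: eq_bigr => A _.
  by rewrite hornerZ hornerXn expr1n mulr1.
rewrite mulr1 distrC => ->.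
move: c01; rewrite in_itv/= => c01.
rewrite /dh normrM ger0_norm ?expR_ge0//.
(* The factor [expR (- lam * c)] is at most 1 because [lam] and [c] are nonnegative. *)
apply: (le_trans _ (stein_bound c01)).
rewrite ler_piMl// -[leRHS]expR0 ler_expR mulNr oppr_le0 mulr_ge0//.
by case/andP: c01.
Qed.

End FinitePoissonApproximation.

(** * Independence of sigma-algebras *)

Section Independence.
Context d (T : measurableType d) (R : realType) (P : probability T R).
Context (I : finType) (X : I -> {RV P >-> R}).

(** A pi-system generating the sigma-algebra of the variables [X i] with [i] in [J];
    [depends_on J f] is measurability for that sigma-algebra. *)
Definition cylinders (J : {set I}) : set (set T) :=
  [set C | exists2 B : I -> set R, (forall i, measurable (B i)) &
     C = \bigcap_(i in [set` J]) (X i @^-1` B i)].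

Definition depends_on (J : {set I}) (f : T -> R) : Prop :=
  measurable_fun setT (f : g_sigma_algebraType (cylinders J) -> R).

Lemma cylindersT J : cylinders J setT.
Proof.
by exists (fun=> setT) => //; apply/esym; rewrite -subTset => t _ i.
Qed.

Lemma setI_closed_cylinders J : setI_closed (cylinders J).
Proof.
move=> _ _ [A mA ->] [B mB ->]; exists (fun i => A i `&` B i).
  by move=> i; exact: measurableI.
by rewrite -bigcapI.
Qed.

Lemma sub_cylinders J : cylinders J `<=` measurable.
Proof.
move=> _ [B mB ->]; apply: fin_bigcap_measurable; first exact: finite_finset.
by move=> i _; rewrite -[X in measurable X]setTI; exact: measurable_funP.
Qed.

Lemma cylinders_measurable J A : <<s cylinders J >> A -> measurable A.
Proof.
apply: smallest_sub; first exact: sigma_algebra_measurable.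
exact: sub_cylinders.
Qed.

Lemma depends_on_measurable J f : depends_on J f -> measurable_fun setT f.
Proof. by move=> mf _ B mB; apply: (@cylinders_measurable J); exact: mf. Qed.

Lemma depends_on_preimage J f B : depends_on J f -> measurable B ->
  <<s cylinders J >> (f @^-1` B).
Proof. by move=> mf mB; rewrite -[_ @^-1` _]setTI; exact: mf. Qed.

Lemma depends_on_RV (J : {set I}) i : i \in J -> depends_on J (X i).
Proof.
move=> iJ _ B mB; rewrite setTI; apply: sub_sigma_algebra.
exists (fun j => if j == i then B else setT); first by move=> j; case: ifP.
apply/seteqP; split=> [t tB j /= jJ|t /(_ _ iJ)/=]; last by rewrite eqxx.
by case: eqP => // ->.
Qed.

Lemma depends_on_sum (J : {set I}) (Q : pred I) : (forall i, Q i -> i \in J) ->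
  depends_on J (fun t => \sum_(i | Q i) X i t).
Proof.
move=> QJ; have -> : (fun t => \sum_(i | Q i) X i t) =
    (fun t => \sum_i (if Q i then X i t else 0)).
  by apply/funext => t; rewrite big_mkcond.
apply: (@measurable_sum _ (g_sigma_algebraType (cylinders J))) => i.
case: (boolP (Q i)) => [Qi|_]; first exact: (depends_on_RV (QJ _ Qi)).
exact: measurable_cst.
Qed.

Hypothesis X_indep : mutually_independent X.

(** The intersection of cylinders over disjoint index sets is a cylinder over their union, and the
    product given by mutual independence splits accordingly. *)
Let cylinders_indep (J1 J2 : {set I}) A B : [disjoint J1 & J2]%B ->
  cylinders J1 A -> cylinders J2 B -> P (A `&` B) = (P A * P B)%E.
Proof.
move=> J12 [A_ mA ->] [B_ mB ->]; rewrite !X_indep//.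
pose C i := if i \in J1 then A_ i else B_ i.
have CB i : i \in J2 -> C i = B_ i.
  by move=> iJ2; rewrite /C (disjointFl J12 iJ2).
have CA i : i \in J1 -> C i = A_ i by rewrite /C => ->.
have -> : \bigcap_(i in [set` J1]) (X i @^-1` A_ i) `&`
    \bigcap_(i in [set` J2]) (X i @^-1` B_ i) =
    \bigcap_(i in [set` (J1 :|: J2)%SET]) (X i @^-1` C i).
  apply/seteqP; split=> [t [tA tB] i /=|t tC].
    rewrite inE => /orP[iJ|iJ]; [rewrite CA//|rewrite CB//].
    - exact: tA.
    - exact: tB.
  split=> i /= iJ; [rewrite -CA//|rewrite -CB//]; apply: tC => /=.
  - by rewrite inE iJ.
  - by rewrite inE iJ orbT.
rewrite X_indep; last by move=> i; rewrite /C; case: ifP.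
rewrite (eq_bigl [predU J1 & J2]) => [|i]; last by rewrite !inE.
rewrite bigU//=; congr (_ * _)%E.
- by apply: eq_bigr => i /CA ->.
- by apply: eq_bigr => i /CB ->.
Qed.

(** As functions of [A], both sides are finite measures; they agree on a pi-system containing the
    whole space, hence on the sigma-algebra it generates. *)
Let eq_measure_indep J B : measurable B ->
  (forall A, cylinders J A -> P (A `&` B) = (P A * P B)%E) ->
  forall A, <<s cylinders J >> A -> P (A `&` B) = (P A * P B)%E.
Proof.
move=> mB indB A sA.
have PB0 : 0 <= fine (P B) by rewrite fine_ge0.
have PBE : P B = (fine (P B))%:E by rewrite fineK// fin_num_measure.
pose m1 := mrestr P mB; pose m2 := mscale (NngNum PB0) P.
have m2E C : m2 C = (P C * P B)%E by rewrite muleC PBE.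
transitivity (m2 A); last exact: m2E.
apply: (@g_sigma_algebra_measure_unique _ _ _ (cylinders J) (@sub_cylinders J)
  (fun=> setT) (fun=> cylindersT J) _ m1 m2 (@setI_closed_cylinders J)) => //.
- by rewrite bigcup_const.
- by move=> C cC; rewrite [RHS]m2E -indB.
- move=> _; rewrite /m1/= /mrestr setTI.
  by rewrite (le_lt_trans (probability_le1 _ _))// ltry.
Qed.

(** Independence extends from cylinders to the generated sigma-algebras one argument at a time, by
    two uses of [eq_measure_indep]. *)
Lemma sigma_cylinders_indep (J1 J2 : {set I}) A B : [disjoint J1 & J2]%B ->
  <<s cylinders J1 >> A -> <<s cylinders J2 >> B -> P (A `&` B) = (P A * P B)%E.
Proof.
move=> J12 sA sB; apply: (@eq_measure_indep J1) => //.
  exact: cylinders_measurable sB.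
move=> {sA}{}A cA; rewrite setIC muleC.
apply: (@eq_measure_indep J2) => //; first exact: sub_cylinders cA.
by move=> C cC; rewrite setIC muleC; exact: cylinders_indep J12 cA cC.
Qed.

End Independence.

(** * Sums of independent uniform variables *)

Section Convolution.
Context d (T : measurableType d) (R : realType) (P : probability T R).

Definition indep_fun (U M : T -> R) : Prop :=
  forall A B, measurable A -> measurable B ->
    P (U @^-1` A `&` M @^-1` B) = (P (U @^-1` A) * P (M @^-1` B))%E.

(* The case split makes the value at 0 vanish even for [a = 0], where the
   monomial gives [c * 0 ^+ 0 = c]. *)
Definition monomial_cdf (c : R) (a : nat) (x : R) : R :=
  if x <= 0 then 0 else c * x ^+ a / a`!%:R.

Lemma measurable_sum_lt (x : R) : measurable [set z : R * R | z.1 + z.2 < x].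
Proof.
have mD : measurable_fun setT (fun z : R * R => z.1 + z.2).
  exact: measurable_funD.
have -> : [set z : R * R | z.1 + z.2 < x] =
    setT `&` (fun z : R * R => z.1 + z.2) @^-1` `]-oo, x[.
  by apply/seteqP; split=> z; rewrite /= in_itv/= => // -[].
exact: mD.
Qed.

(** Independence makes the joint law of [U] and [M] the product of their laws; the product measure
    of a half-plane is the integral of the measures of its sections. *)
Lemma prob_add_indep (U M : {mfun T >-> R}) (x : R) : indep_fun U M ->
  P [set t | U t + M t < x] =
  (\int[distribution P U]_u P [set t | (M t < x - u)%R])%E.
Proof.
move=> UM.
pose UMf t := (U t, M t).
have mUM : measurable_fun setT UMf by exact/measurable_fun_pair.
pose pr : {mfun T >-> (R * R)%type} := mfun_Sub (mem_set mUM).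
have distE S : distribution P pr S = P (UMf @^-1` S) by [].
have mS := measurable_sum_lt x.
transitivity (distribution P pr [set z : R * R | z.1 + z.2 < x]).
  by rewrite distE.
rewrite -(@product_measure_unique _ _ _ _ _ (distribution P U) (distribution P M))//.
  apply: eq_integral => u _; rewrite /distribution /pushforward; congr (P _).
  by apply/seteqP; split=> t; rewrite /= /xsection/= inE/= ltrBrDl.
Qed.

Lemma measurable_prob_shift (M : {mfun T >-> R}) (x : R) :
  measurable_fun setT (fun u : R => P [set t | M t < x - u]).
Proof.
have := measurable_fun_xsection (distribution P M) (measurable_sum_lt x).
apply: eq_measurable_fun => u _ /=; rewrite /distribution /pushforward.
by congr (P _); apply/seteqP; split=> t; rewrite /= /xsection/= inE/= ltrBrDl.
Qed.

Lemma integral_monomial (c x : R) (a : nat) : 0 < x ->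
  (\int[lebesgue_measure]_(u in `[0%R, x]) (c * (x - u) ^+ a / a`!%:R)%R%:E =
   (c * x ^+ a.+1 / a.+1`!%:R)%R%:E)%E.
Proof.
move=> x0.
pose f : {poly R} := (c / a`!%:R) *: (x%:P - 'X) ^+ a.
(* An antiderivative of [f]; it vanishes at [x], so only its value at 0 contributes. *)
pose F : {poly R} := (- (c / a.+1`!%:R)) *: (x%:P - 'X) ^+ a.+1.
have fE u : f.[u] = c * (x - u) ^+ a / a`!%:R.
  by rewrite !hornerE/=; ring.
have FE u : F.[u] = - (c / a.+1`!%:R) * (x - u) ^+ a.+1.
  by rewrite !hornerE.
have dF u : F^`().[u] = f.[u].
  rewrite fE /F derivZ deriv_exp derivB derivC derivX.
  rewrite hornerZ hornerMn !hornerE/= -[_ *+ a.+1]mulr_natr.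
  rewrite factS natrM.
  have a0 : a.+1%:R != 0 :> R by rewrite pnatr_eq0.
  have f0 : a`!%:R != 0 :> R by rewrite pnatr_eq0 -lt0n fact_gt0.
  move: (a.+1%:R) (a`!%:R) a0 f0 => y w y0 w0; field.
  by rewrite y0 w0.
have ch (p : {poly R}) : continuous (horner p).
  move=> u; apply/differentiable_continuous/derivable1_diffP.
  exact: derivable_horner.
under eq_integral do rewrite -fE.
rewrite (@continuous_FTC2 _ _ (horner F))//.
- by rewrite !FE subrr expr0n/= mulr0 subr0 -EFinB sub0r mulNr opprK mulrAC.
- exact/continuous_subspaceT.
- split => [u _||]; first exact: derivable_horner.
  + exact/cvg_at_right_filter/ch.
  + exact/cvg_at_left_filter/ch.
- move=> u _; rewrite derive1E -dF.
  by rewrite (@derive_val _ _ _ _ _ _ _ (is_derive_poly F u)).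
Qed.

(** Conditioning on [U = u] turns the probability into the integral of [monomial_cdf c a (x - u)]
    over [[0, 1]], and integrating the monomial raises its degree by one. The bound [x <= 1] keeps
    [[0, x]] inside the support of [U]. *)
Lemma monomial_cdf_add (U M : {mfun T >-> R}) (c : R) (a : nat) :
  indep_fun U M -> uniform01 (P := P) U ->
  (forall x, x <= 1 -> P [set t | M t < x] = (monomial_cdf c a x)%:E) ->
  forall x, x <= 1 -> P [set t | U t + M t < x] = (monomial_cdf c a.+1 x)%:E.
Proof.
move=> UM unifU cdfM x x1; rewrite prob_add_indep//.
(* [uniform_prob] lives on the Borel structure [measurableTypeR R], whose
   measures do not typecheck as measures on [R]. *)
have mU : measurable_fun setT (U : T -> measurableTypeR R).
  by move=> mT B mB; exact: (measurable_funP U mT B mB).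
pose U' : {mfun T >-> measurableTypeR R} :=
  @mfun_Sub _ _ T (measurableTypeR R) U (mem_set mU).
have mprob := measurable_prob_shift M x.
transitivity (\int[distribution P U']_u P [set t | (M t < x - u)%R])%E.
  by rewrite !ge0_integral_distribution.
rewrite (eq_measure_integral (uniform_prob (@ltr01 R))); last first.
  by move=> A mA _; exact: unifU.
rewrite integral_uniform//.
rewrite subr0 invr1 mul1e.
have cdfMu u : 0 <= u -> P [set t | M t < x - u] = (monomial_cdf c a (x - u))%:E.
  by move=> u0; rewrite cdfM// lerBlDr (le_trans x1)// lerDl.
rewrite /monomial_cdf; have [x0|x0] := leP x 0.
  apply: integral0_eq => u /=; rewrite in_itv/= => /andP[u0 _].
  by rewrite cdfMu// /monomial_cdf ifT// subr_le0 (le_trans x0).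
(* For [u >= x] the argument [x - u] is nonpositive and the integrand is 0, so only [[0, x[]
   counts. *)
have -> : `[0, 1]%classic = `[0, x[ `|` `[x, 1] :> set R.
  by rewrite -itv_bndbnd_setU ?bnd_simp// ltW.
rewrite ge0_integral_setU//; last 2 first.
- exact: measurable_funTS mprob.
- apply/disj_setPS => u [/=]; rewrite !in_itv/= => /andP[_ ux] /andP[xu _].
  by move: (lt_le_trans ux xu); rewrite ltxx.
rewrite [X in (_ + X)%E]integral0_eq ?adde0; last first.
  move=> u /=; rewrite in_itv/= => /andP[xu _].
  by rewrite cdfMu ?(le_trans (ltW x0))// /monomial_cdf ifT// subr_le0.
rewrite -integral_monomial// -integral_itv_bndo_bndc; last first.
  apply: measurable_funTS; apply/measurable_EFinP.
  apply: measurable_funM => //; apply: measurable_funM => //.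
  by apply: measurable_funX; apply: measurable_funB.
apply: eq_integral => u; rewrite inE/= in_itv/= => /andP[u0 ux].
by rewrite cdfMu// /monomial_cdf ifF// leNgt subr_gt0 ux.
Qed.


End Convolution.

(** * Poisson approximation for events *)

Section EventPattern.
Context d (T : measurableType d) (I : finType) (E : I -> set T).

Definition occurring (t : T) : {set I} := [set i | `[< E i t >]]%SET.

Lemma in_occurring t i : (i \in occurring t) = `[< E i t >].
Proof. by rewrite inE. Qed.

(** Measurability is asked only of the events outside [N], so that the lemma also applies to a
    smaller sigma-algebra which need not contain the events in [N]. *)
Lemma measurable_pattern (N C : {set I}) :
  (forall i, i \notin N -> measurable (E i)) ->
  measurable [set t | (occurring t :\: N)%SET = C].
Proof.
move=> mE.
(* [F i] is the constraint at index [i]. An index of [N] is never in the difference, so its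
   constraint is void unless [i] is in [C], when it is impossible. *)
pose F i := if i \in N then (if i \in C then set0 else setT)
            else if i \in C then E i else ~` E i.
have -> : [set t | (occurring t :\: N)%SET = C] = \bigcap_i F i.
  apply/seteqP; split=> [t /= tC i _|t tF].
    rewrite /F -tC !inE; case: (i \in N) => //=.
    by case: asboolP.
  apply/setP => i; have := tF i Logic.I; rewrite /F !inE.
  case: (i \in N) => /=; first by case: (i \in C).
  by case: (i \in C) => /= h; apply/asboolP.
apply: fin_bigcap_measurable => [|i _]; first exact: finite_finset.
rewrite /F; case: (boolP (i \in N)) => iN; case: (i \in C) => //.
- exact: mE.
- exact/measurableC/mE.
Qed.

End EventPattern.

Section EventsPoissonApproximation.
Context d (T : measurableType d) (R : realType) (P : probability T R).
Context (I : finType) (E : I -> set T) (N : I -> {set I}).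
Hypothesis mE : forall i, measurable (E i).

Let q (A : {set I}) : R := fine (P [set t | occurring E t = A]).

Let measurable_occurring A : measurable [set t | occurring E t = A].
Proof.
have := @measurable_pattern _ _ _ E finset.set0 A (fun i _ => mE i).
by under eq_set do rewrite finset.setD0.
Qed.

Let prob_pattern (Q : pred {set I}) :
  fine (P [set t | Q (occurring E t)]) = \sum_(A | Q A) q A.
Proof.
have -> : [set t | Q (occurring E t)] =
    \bigcup_(A in [set` Q]) [set t | occurring E t = A].
  apply/seteqP; split=> [t /= Qt|t [A /= QA tA]]; last by rewrite tA.
  by exists (occurring E t).
rewrite measure_fin_bigcup//.
- rewrite (@fsbigE _ _ _ _ _ (enum Q)) ?enum_uniq//; last 2 first.
  + by move=> A; rewrite /= mem_enum.
  + by move=> A /= QA; rewrite mem_enum => /negP; case.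
  rewrite big_enum_cond (eq_bigr (fun A => (q A)%:E)) => [|A _]; last first.
    by rewrite /q fineK// fin_num_measure.
  rewrite sumEFin/=; apply: eq_bigl => A.
  by rewrite mem_setE/= andbb.
- by move=> A B _ _ [t [/= tA tB]]; rewrite -tA -tB.
Qed.

(** The finite statement applied to [q], the law of the random set [occurring E]; [prob_pattern]
    translates each probability into a sum of values of [q]. *)
Lemma events_poisson_approximation :
  (forall i, i \in N i) ->
  (forall i C, P (E i `&` [set t | (occurring E t :\: N i)%SET = C]) =
     (P (E i) * P [set t | (occurring E t :\: N i)%SET = C])%E) ->
  `|fine (P (~` \bigcup_i E i)) - expR (- \sum_i fine (P (E i)))| <=
  \sum_i \sum_(j in N i) fine (P (E i)) * fine (P (E j)) +
  \sum_i \sum_(j in N i | j != i) fine (P (E i `&` E j)).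
Proof.
move=> self_near far_indep.
have p1 i : fine (P (E i)) = occ_prob q i.
  rewrite -[RHS](prob_pattern (fun A : {set I} => i \in A)); congr (fine (P _)).
  by apply/seteqP; split=> t; rewrite /= in_occurring => /asboolP.
have p2 i j : fine (P (E i `&` E j)) = cooc_prob q i j.
  rewrite -[RHS](prob_pattern (fun A : {set I} => (i \in A) && (j \in A))).
  congr (fine (P _)).
  apply/seteqP; split=> t; rewrite /= !in_occurring.
    by move=> [/asboolP -> /asboolP ->].
  by move=> /andP[/asboolP ? /asboolP].
have p0 : fine (P (~` \bigcup_i E i)) = q finset.set0.
  rewrite /q; congr (fine (P _)); apply/seteqP; split=> [t tE|t /= t0 [i _ Eit]].
    apply/setP => i; rewrite in_occurring inE; apply/asboolP => Eit.
    by apply: tE; exists i.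
  by have := in_occurring E t i; rewrite t0 inE; move=> /esym/asboolP.
rewrite p0.
under eq_bigr do rewrite p1.
under [X in _ <= X + _]eq_bigr do under eq_bigr do rewrite !p1.
under [X in _ <= _ + X]eq_bigr do under eq_bigr do rewrite p2.
apply: poisson_approximation => //.
- by move=> A; rewrite fine_ge0.
- rewrite -(prob_pattern xpredT) (_ : [set t | _] = setT).
    by rewrite probability_setT.
  by apply/seteqP; split.
- move=> i C; rewrite -p1.
  rewrite -(prob_pattern
    (fun A : {set I} => (i \in A) && (A :\: N i == C)%SET)).
  rewrite -(prob_pattern (fun A : {set I} => (A :\: N i == C)%SET)).
  have eqC : [set t | (occurring E t :\: N i == C)%SET] =
      [set t | (occurring E t :\: N i)%SET = C].
    by apply/seteqP; split=> t /= /eqP.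
  have mC : measurable [set t | (occurring E t :\: N i)%SET = C].
    exact: measurable_pattern.
  rewrite eqC -fineM ?fin_num_measure// -far_indep; congr (fine (P _)).
  apply/seteqP; split=> t /=; rewrite in_occurring.
    by move=> /andP[/asboolP Et /eqP].
  by move=> [Et /eqP tC]; rewrite tC andbT; apply/asboolP.
Qed.

End EventsPoissonApproximation.

(** * Weights of overlapping edge sets *)

Section SumsOfUniforms.
Context d (T : measurableType d) (R : realType) (P : probability T R).
Context (I : finType) (X : I -> {RV P >-> R}).
Hypothesis X_indep : mutually_independent X.
Hypothesis X_unif : forall i, uniform01 (X i).

(** A cylinder over [J] is a cylinder over [K] with no constraint on the additional indices. *)
Lemma depends_on_sub (J K : {set I}) f : J \subset K ->
  depends_on X J f -> depends_on X K f.
Proof.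
move=> JK fJ _ B mB; move: (fJ measurableT B mB).
suff : <<s cylinders X J >> `<=` <<s cylinders X K >> by apply.
apply: smallest_sub; first exact: smallest_sigma_algebra.
move=> _ [A_ mA ->]; apply: sub_sigma_algebra.
exists (fun i => if i \in J then A_ i else setT) => [i|]; first by case: ifP.
apply/seteqP; split=> t tA i /=; first by case: ifP => // iJ _; exact: tA.
by move=> iJ; have := tA i (fintype.subsetP JK i iJ); rewrite /= iJ.
Qed.

Lemma depends_on_add (J : {set I}) f g : depends_on X J f -> depends_on X J g ->
  depends_on X J (fun t => f t + g t).
Proof. exact: measurable_funD. Qed.

Lemma depends_on_max (J : {set I}) f g : depends_on X J f -> depends_on X J g ->
  depends_on X J (f \max g).
Proof. exact: measurable_maxr. Qed.

Lemma depends_on_indep (J K : {set I}) f g : [disjoint J & K]%B ->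
  depends_on X J f -> depends_on X K g -> indep_fun P f g.
Proof.
move=> JK fJ gK A B mA mB.
by apply: (sigma_cylinders_indep X_indep JK); exact: depends_on_preimage.
Qed.

Definition sum_over (J : {set I}) (t : T) : R := \sum_(i in J) X i t.

Lemma depends_on_sum_over (J : {set I}) : depends_on X J (sum_over J).
Proof. exact: depends_on_sum. Qed.

(** Induction on the size of [J]: the variable removed from [J] is independent of the remaining sum
    together with [M], so [monomial_cdf_add] applies once per index. *)
Lemma cdf_sum_over_add (J K : {set I}) (M : T -> R) (c : R) (a : nat) :
  [disjoint J & K]%B -> depends_on X K M ->
  (forall x, x <= 1 -> P [set t | M t < x] = (monomial_cdf c a x)%:E) ->
  forall x, x <= 1 ->
    P [set t | sum_over J t + M t < x] = (monomial_cdf c (#|J| + a) x)%:E.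
Proof.
move=> JK MK cdfM; move cardJ : #|J| => m.
elim: m J JK cardJ => [|m IHm] J JK cardJ x x1.
  rewrite -cdfM//; congr (P _); apply/seteqP; split=> t /=;
    by rewrite /sum_over (cards0_eq cardJ) big_set0 add0r.
have [i iJ] : exists i, i \in J by apply/card_gt0P; rewrite cardJ.
pose J' := (J :\ i)%SET.
have J'K : [disjoint J' & K]%B by apply: disjointWl JK; exact: subsetDl.
have cardJ' : #|J'| = m by have := cardsD1 i J; rewrite iJ cardJ => -[].
pose M' t := sum_over J' t + M t.
have M'dep : depends_on X (J' :|: K)%SET M'.
  exact: (depends_on_add (depends_on_sub (finset.subsetUl _ _)
    (@depends_on_sum_over J')) (depends_on_sub (finset.subsetUr _ _) MK)).
have iUK : [disjoint [set i]%SET & (J' :|: K)%SET]%B.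
  by rewrite disjoints1 !inE eqxx/= (disjointFr JK iJ).
have mM' := depends_on_measurable M'dep.
pose M'' : {mfun T >-> R} := mfun_Sub (mem_set mM').
have XM : indep_fun P (X i) M''.
  by apply: depends_on_indep iUK _ M'dep; apply: depends_on_RV; rewrite inE.
rewrite addSn.
rewrite -(@monomial_cdf_add _ _ _ P (X i) M'' c (m + a) XM (X_unif i))//.
  congr (P _); apply/seteqP; split=> t /=;
    by rewrite /M'/sum_over (big_setD1 i iJ)/= addrA.
exact: IHm J'K cardJ'.
Qed.

Lemma cdf_sum_over (J : {set I}) x : x <= 1 ->
  P [set t | sum_over J t < x] = (monomial_cdf 1 #|J| x)%:E.
Proof.
move=> x1.
have -> : [set t | sum_over J t < x] = [set t | sum_over J t + 0 < x].
  by apply/seteqP; split=> t /=; rewrite addr0.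
(* The recursion starts from the constant 0: the probability that [0 < x] is the unit step
   [monomial_cdf 1 0 x], which is 0 at [x = 0] because the inequality is strict. *)
rewrite (@cdf_sum_over_add J finset.set0 (fun=> 0) 1 0) ?addn0//.
- by rewrite -finset.setI_eq0 finset.setI0.
- exact: measurable_cst.
move=> y _; rewrite /monomial_cdf; case: leP => y0.
  rewrite (_ : [set _ | _] = set0) ?measure0//.
  by apply/seteqP; split=> t //=; rewrite ltNge y0.
rewrite (_ : [set _ | _] = setT) ?probability_setT ?expr0 ?fact0 ?divr1 ?mul1r//.
by apply/seteqP; split.
Qed.

(** Both sums contain the sum over [J :&: K], so both lie below [x] exactly when this common part
    plus the maximum of the two private parts does. *)
Lemma cdf_sum_over2 (J K : {set I}) (r : nat) x :
  #|J :\: K|%SET = r -> #|K :\: J|%SET = r -> x <= 1 ->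
  P ([set t | sum_over J t < x] `&` [set t | sum_over K t < x]) =
  (monomial_cdf 'C(2 * r, r)%:R (#|J| + r) x)%:E.
Proof.
move=> JKr KJr x1.
pose Z := sum_over (J :\: K)%SET; pose Z' := sum_over (K :\: J)%SET.
pose U := ((J :\: K) :|: (K :\: J))%SET.
have ZZ' : indep_fun P Z Z'.
  apply: depends_on_indep (@depends_on_sum_over _) (@depends_on_sum_over _).
  rewrite -finset.setI_eq0; apply/eqP/setP => i; rewrite !inE.
  by case: (i \in J); case: (i \in K).
have depM : depends_on X U (Z \max Z').
  exact: (depends_on_max (depends_on_sub (finset.subsetUl _ _)
    (@depends_on_sum_over _)) (depends_on_sub (finset.subsetUr _ _)
    (@depends_on_sum_over _))).
have cdfM y : y <= 1 ->
    P [set t | (Z \max Z') t < y] = (monomial_cdf 'C(2 * r, r)%:R (2 * r) y)%:E.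
  move=> y1.
  have -> : [set t | (Z \max Z') t < y] = Z @^-1` `]-oo, y[ `&` Z' @^-1` `]-oo, y[.
    by apply/seteqP; split=> t /=; rewrite !in_itv/= gt_max => /andP.
  rewrite ZZ'//.
  have E J' : P (sum_over J' @^-1` `]-oo, y[) = (monomial_cdf 1 #|J'| y)%:E.
    have <- : [set t | sum_over J' t < y] = sum_over J' @^-1` `]-oo, y[.
      by apply/seteqP; split=> t /=; rewrite in_itv.
    exact: cdf_sum_over.
  rewrite !E JKr KJr -EFinM /monomial_cdf; case: leP => y0; first by rewrite mulr0.
  (* The product of the two laws is [(y ^+ r / r!) ^+ 2], which equals [y ^+ (2 * r) / (2 * r)!]
     times the binomial coefficient ['C(2 * r, r)]. *)
  congr EFin; have := @bin_fact (2 * r) r; rewrite mul2n -addnn addnK leq_addr.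
  move=> /(_ isT) <-; rewrite !natrM exprD.
  have r0 : r`!%:R != 0 :> R by rewrite pnatr_eq0 -lt0n fact_gt0.
  have b0 : 'C(r + r, r)%:R != 0 :> R by rewrite pnatr_eq0 -lt0n bin_gt0 leq_addr.
  by field; rewrite r0 b0.
have -> : [set t | sum_over J t < x] `&` [set t | sum_over K t < x] =
    [set t | sum_over (J :&: K)%SET t + (Z \max Z') t < x].
  have e1 t : sum_over J t = sum_over (J :&: K)%SET t + Z t.
    by rewrite /Z /sum_over (big_setID K).
  have e2 t : sum_over K t = sum_over (J :&: K)%SET t + Z' t.
    by rewrite /Z' /sum_over (big_setID J)/= finset.setIC.
  by apply/seteqP; split=> t /=; rewrite addr_maxr gt_max e1 e2 => /andP.
rewrite (cdf_sum_over_add _ depM cdfM)//; last first.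
  rewrite -finset.setI_eq0; apply/eqP/setP => i; rewrite !inE.
  by case: (i \in J); case: (i \in K).
congr ((monomial_cdf _ _ _)%:E).
(* The exponent: the common part together with both private parts has size [#|J| + r]. *)
by rewrite -(cardsID K J) JKr -addnA addnn mul2n.
Qed.

End SumsOfUniforms.

(** * Counting overlaps and edges *)

(** Such a set [A] corresponds to the pair formed by its part inside [S] and its part outside, which
    are chosen independently. *)
Lemma card_overlap (T : finType) (S : {set T}) (m l : nat) : (l <= m)%N ->
  #|[set A : {set T} | (#|A| == m) && (#|A :&: S| == l)]%SET| =
  ('C(#|S|, l) * 'C(#|T| - #|S|, m - l))%N.
Proof.
move=> lm.
pose D1 := [set A : {set T} | A \subset S & #|A| == l]%SET.
pose D2 := [set A : {set T} | A \subset ~: S & #|A| == (m - l)%N]%SET.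
have -> : [set A : {set T} | (#|A| == m) && (#|A :&: S| == l)]%SET =
    [set (p.1 :|: p.2)%SET | p in finset.setX D1 D2]%SET.
  apply/setP => A; rewrite inE; apply/idP/imsetP.
    move=> /andP[/eqP Am /eqP Al]; exists (A :&: S, A :\: S)%SET => /=; last first.
      by rewrite finset.setID.
    rewrite !inE/= finset.subsetIr Al eqxx/= finset.subsetDr/=.
    by rewrite -(cardsID S A) Al in Am; rewrite -Am addKn.
  move=> [[B C]]; rewrite !inE/= => /andP[/andP[BS /eqP Bl] /andP[CS /eqP Cl]] ->.
  have BC : (B :&: C = finset.set0)%SET.
    apply/eqP; rewrite finset.setI_eq0 (disjointWl BS)// disjoint_sym.
    by rewrite finset.disjoints_subset.
  rewrite cardsU BC cards0 subn0 Bl Cl subnKC// eqxx/=.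
  rewrite finset.setIUl (finset.setIidPl BS).
  have -> : (C :&: S = finset.set0)%SET.
    by apply/eqP; rewrite finset.setI_eq0 finset.disjoints_subset.
  by rewrite finset.setU0 Bl.
rewrite card_in_imset.
  by rewrite cardsX !cards_draws (cardsCs (~: S)%SET) finset.setCK.
move=> [B C] [B' C']; rewrite !inE/=.
move=> /andP[/andP[BS _] /andP[CS _]] /andP[/andP[BS' _] /andP[CS' _]] eU.
(* Both parts can be read off from the union, so the union map is injective on these pairs. *)
have split1 (U V : {set T}) : U \subset S -> V \subset ~: S ->
    ((U :|: V) :&: S = U)%SET /\ ((U :|: V) :\: S = V)%SET.
  move=> US VS; split; apply/setP => x; rewrite !inE.
    have := fintype.subsetP US x; have := fintype.subsetP VS x; rewrite !inE.
    by case: (x \in U); case: (x \in V); case: (x \in S) => //= h1 h2;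
      [have := h2 isT|have := h2 isT|have := h1 isT].
  have := fintype.subsetP US x; have := fintype.subsetP VS x; rewrite !inE.
  by case: (x \in U); case: (x \in V); case: (x \in S) => //= h1 h2;
      [have := h1 isT|have := h2 isT|have := h1 isT].
have [e1 e2] := split1 _ _ BS CS; have [e3 e4] := split1 _ _ BS' CS'.
by congr pair; [rewrite -e1 eU e3|rewrite -e2 eU e4].
Qed.

Lemma sum_overlap (R : realType) (n k : nat) (S : {set 'I_n}) (g : nat -> R) :
  #|S| = k ->
  \sum_(A : {set 'I_n} | (#|A| == k) && (1 < #|A :&: S|)%N) g #|A :&: S|%SET =
  \sum_(2 <= l < k.+1) (nb_overlap k n l)%:R * g l.
Proof.
move=> Sk.
transitivity (\sum_(A : {set 'I_n} | #|A| == k)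
    \sum_(2 <= l < k.+1 | l == #|A :&: S|%SET) g l).
  rewrite big_mkcondr; apply: eq_bigr => A _; rewrite big_nat1_eq.
  by rewrite ltnS -Sk subset_leq_card ?andbT// finset.subsetIr.
rewrite (exchange_big_dep xpredT)//= big_nat [RHS]big_nat.
apply: eq_bigr => l /andP[_ lk].
rewrite sumr_const mulr_natl; congr (_ *+ _).
have := @card_overlap _ S k l lk; rewrite Sk card_ord -/(nb_overlap k n l) => <-.
by apply: eq_card => A; rewrite unfold_in inE [l == _]eq_sym.
Qed.

Section CliqueEdges.
Context (n : nat).

Definition edges_in (S : {set 'I_n}) : {set edge n} :=
  [set e : edge n | sval e \subset S]%SET.

Lemma card_edges_in S : #|edges_in S| = 'C(#|S|, 2).
Proof.
rewrite -cards_draws -(card_imset _ val_inj); congr #|pred_of_set _|.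
apply/setP => A; rewrite inE; apply/imsetP/andP.
  by move=> [e]; rewrite inE => eS ->; split; last exact: (valP e).
by move=> [AS A2]; exists (Sub A A2) => //; rewrite inE.
Qed.

Lemma edges_inI S S' : (edges_in S :&: edges_in S' = edges_in (S :&: S'))%SET.
Proof. by apply/setP => e; rewrite !inE finset.subsetI. Qed.

Lemma card_edges_inD S S' :
  #|edges_in S :\: edges_in S'|%SET = ('C(#|S|, 2) - 'C(#|S :&: S'|, 2))%N.
Proof. by rewrite cardsD edges_inI !card_edges_in. Qed.

(** A common edge would need two common vertices. *)
Lemma disjoint_edges_in S S' : (#|S :&: S'| <= 1)%N ->
  [disjoint edges_in S & edges_in S']%B.
Proof.
move=> SS'; rewrite -finset.setI_eq0 edges_inI -cards_eq0 card_edges_in.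
by rewrite bin_small.
Qed.

Lemma clique_weightE d (T : measurableType d) (R : realType)
    (P : probability T R) (X : edge n -> {RV P >-> R}) S t :
  clique_weight X S t = sum_over X (edges_in S) t.
Proof. by rewrite /clique_weight /sum_over; apply: eq_bigl => e; rewrite inE. Qed.

End CliqueEdges.

(** * Asymptotics of lambda *)

Lemma mul2_bin2 k : (2 * 'C(k, 2) = k * (k - 1))%N.
Proof. by rewrite -mul_bin_diag bin1 subn1. Qed.

(** Induction on [k]: each step multiplies the ratio by [(n - k) / n = 1 - k / n], which tends to
    1. *)
Lemma cvg_ffact_ratio (R : realType) (k : nat) :
  (fun n : nat => (n ^_ k)%:R / n%:R ^+ k) @ \oo --> (1 : R).
Proof.
have cvgV : (fun n : nat => (n%:R : R)^-1) @ \oo --> (0 : R).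
  apply/gtr0_cvgV0; last exact: cvgr_idn.
  by near=> n; rewrite ltr0n; near: n; exact: nbhs_infty_gt.
elim: k => [|k IHk].
  by apply: cvg_near_cst; near=> n; rewrite ffactn0 expr0 divr1.
have : (fun n : nat => (n ^_ k)%:R / n%:R ^+ k * (1 - k%:R * n%:R^-1)) @ \oo -->
    (1 * (1 - k%:R * 0) : R).
  apply: cvgM => //; apply: cvgB; first exact: cvg_cst.
  by apply: cvgM => //; exact: cvg_cst.
rewrite mulr0 subr0 mulr1; apply: cvg_trans; apply: near_eq_cvg.
near=> n.
have n0 : (0 < n)%N by near: n; exact: nbhs_infty_gt.
have kn : (k <= n)%N by near: n; exact: nbhs_infty_ge.
rewrite ffactnSr natrM natrB// exprS.
have n0' : n%:R != 0 :> R by rewrite pnatr_eq0 -lt0n.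
by field; rewrite expf_neq0.
Unshelve. all: by end_near.
Qed.

(** The exponents multiply to [(2 / (k - 1)) * (k * (k - 1) / 2) = k]. *)
Lemma threshold_pow (R : realType) (k n : nat) (z : R) : (1 < k)%N -> (0 < n)%N ->
  threshold k n z ^+ 'C(k, 2) = z ^+ 'C(k, 2) / n%:R ^+ k.
Proof.
move=> k1 n0; rewrite /threshold expr_div_n; congr (_ / _).
rewrite -powR_mulrn ?powR_ge0// -powRrM -powR_mulrn//; congr (_ `^ _).
have k0 : (k - 1)%:R != 0 :> R by rewrite pnatr_eq0 -lt0n subn_gt0.
by rewrite mulrAC -natrM mul2_bin2 natrM mulfK.
Qed.

(** For [n > 0] the ratio equals [n ^_ k] divided by the [k]-th power of [n], since every power of
    [z] and every factorial cancels. *)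
Lemma lambda_cvg (R : realType) (k : nat) (z : R) : (1 < k)%N -> 0 < z ->
  (fun n : nat => lambda k n (threshold k n z) /
       (z ^+ 'C(k, 2) / ((k`!)%:R * ('C(k, 2)`!)%:R))) @ \oo --> (1 : R).
Proof.
move=> k1 z0; have := @cvg_ffact_ratio R k.
apply: cvg_trans; apply: near_eq_cvg; near=> n.
have n0 : (0 < n)%N by near: n; exact: nbhs_infty_gt.
rewrite /lambda threshold_pow// -bin_ffact natrM.
have zm0 : z ^+ 'C(k, 2) != 0 by rewrite expf_neq0// gt_eqF.
have n0' : n%:R ^+ k != 0 :> R by rewrite expf_neq0// pnatr_eq0 -lt0n.
have f0 j : j`!%:R != 0 :> R by rewrite pnatr_eq0 -lt0n fact_gt0.
by field; rewrite n0' zm0 !f0.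
Unshelve. all: by end_near.
Qed.

(** * Light cliques *)

Lemma monomial_cdf_gt0 (R : realType) (c x : R) (a : nat) : (0 < a)%N -> 0 <= x ->
  monomial_cdf c a x = c * x ^+ a / a`!%:R.
Proof.
move=> a0 x0; rewrite /monomial_cdf; case: (leP x 0) => // x0'.
have -> : x = 0 by apply/eqP; rewrite eq_le x0 x0'.
by rewrite expr0n gtn_eqF// mulr0 mul0r.
Qed.

Section CliqueEvents.
Context d (T : measurableType d) (R : realType) (P : probability T R).
Context (n k : nat) (X : edge n -> {RV P >-> R}) (w : R).
Hypotheses (k2 : (2 <= k)%N) (w01 : 0 <= w <= 1).
Hypothesis X_indep : mutually_independent X.
Hypothesis X_unif : forall e, uniform01 (X e).

(** The size condition is part of the event, so that all vertex sets can serve as indices; those of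
    another size contribute the empty event. *)
Definition light_clique (S : {set 'I_n}) : set T :=
  [set t | #|S| = k /\ clique_weight X S t < w].

(** The alternative [S' == S] keeps every index in its own neighbourhood, including sets with fewer
    than two vertices. *)
Definition near_clique (S : {set 'I_n}) : {set {set 'I_n}} :=
  [set S' : {set 'I_n} | (S' == S) || (1 < #|S' :&: S|)%N]%SET.

Let light_cliqueE (S : {set 'I_n}) : #|S| = k ->
  light_clique S = [set t | sum_over X (edges_in S) t < w].
Proof.
move=> Sk; apply/seteqP; split=> t; rewrite /light_clique/= clique_weightE //.
by case.
Qed.

Let light_clique0 (S : {set 'I_n}) : #|S| != k -> light_clique S = set0.
Proof. by move=> Sk; rewrite -subset0 => t [/eqP]; rewrite (negbTE Sk). Qed.

Let light_clique_depends (S : {set 'I_n}) (J : {set edge n}) : edges_in S \subset J ->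
  <<s cylinders X J >> (light_clique S).
Proof.
move=> SJ; have [Sk|Sk] := eqVneq #|S| k; last first.
  by rewrite light_clique0//; exact: sigma_algebra0.
have -> : light_clique S = sum_over X (edges_in S) @^-1` `]-oo, w[.
  by rewrite light_cliqueE//; apply/seteqP; split=> t /=; rewrite in_itv.
apply: depends_on_preimage => //.
exact: (depends_on_sub SJ (@depends_on_sum_over _ _ _ _ _ X _)).
Qed.

Lemma measurable_light_clique S : measurable (light_clique S).
Proof.
exact: (cylinders_measurable (light_clique_depends (fintype.subxx _))).
Qed.

Let bin2_gt0 : (0 < 'C(k, 2))%N. Proof. by rewrite bin_gt0. Qed.

Let prob_light_clique S : fine (P (light_clique S)) =
  if #|S| == k then clique_prob k w else 0.
Proof.
case: eqP => [Sk|/eqP Sk]; last by rewrite light_clique0// measure0.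
case/andP: w01 => w0 w1.
rewrite light_cliqueE// cdf_sum_over//= card_edges_in Sk.
by rewrite monomial_cdf_gt0// mul1r.
Qed.

Let pair_bound l := w ^+ ('C(k, 2) + nb_new_edges k l)
  / (('C(k, 2) + nb_new_edges k l)`!)%:R
  * 'C(2 * nb_new_edges k l, nb_new_edges k l)%:R.

Let prob_light_clique2 (S S' : {set 'I_n}) : #|S| = k -> #|S'| = k ->
  fine (P (light_clique S `&` light_clique S')) = pair_bound #|S' :&: S|%SET.
Proof.
move=> Sk S'k; case/andP: w01 => w0 w1; rewrite !light_cliqueE//.
rewrite (@cdf_sum_over2 _ _ _ _ _ _ X_indep X_unif _ _
  (nb_new_edges k #|S' :&: S|))//=.
- by rewrite monomial_cdf_gt0 ?addn_gt0 ?card_edges_in ?Sk ?bin2_gt0// /pair_bound; ring.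
- by rewrite card_edges_inD Sk finset.setIC.
- by rewrite card_edges_inD S'k.
Qed.

(** A clique outside the neighbourhood of [S] shares no edge with [S]. The pattern of far light
    cliques is therefore determined by the weights of the edges outside [S], and disjoint edge
    families are independent. *)
Let far_light_clique_indep S (C : {set {set 'I_n}}) :
  let far := [set t | (occurring light_clique t :\: near_clique S)%SET = C] in
  P (light_clique S `&` far) = (P (light_clique S) * P far)%E.
Proof.
move=> far.
apply: (sigma_cylinders_indep X_indep (J1 := edges_in S) (J2 := (~: edges_in S)%SET)).
- by rewrite -finset.setI_eq0 finset.setICr.
- exact: light_clique_depends.
apply: (@measurable_pattern _ (g_sigma_algebraType (cylinders X (~: edges_in S)%SET))).
move=> S'; rewrite inE negb_or -leqNgt => /andP[_ S'S].
apply: light_clique_depends; rewrite -finset.disjoints_subset.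
exact: disjoint_edges_in.
Qed.

Let sum_cliques (f : {set 'I_n} -> R) c :
  (forall S : {set 'I_n}, #|S| = k -> f S = c) ->
  (forall S : {set 'I_n}, #|S| != k -> f S = 0) ->
  \sum_S f S = 'C(n, k)%:R * c.
Proof.
move=> fk f0; rewrite (bigID (fun S : {set 'I_n} => #|S| == k))/=.
rewrite [X in _ + X]big1 ?addr0; last by move=> S; exact: f0.
rewrite (eq_bigr (fun=> c)) => [|S /eqP]; last exact: fk.
by rewrite sumr_const -[in RHS](card_ord n) -card_draws mulr_natl cardsE.
Qed.

Lemma clique_poisson_approximation :
  `|fine (P (~` \bigcup_S light_clique S)) - expR (- lambda k n w)| <=
  b1 k n w + b2 k n w.
Proof.
have := events_poisson_approximation measurable_light_clique _
  far_light_clique_indep.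
rewrite (sum_cliques (c := clique_prob k w)); last 2 first.
- by move=> S Sk; rewrite prob_light_clique Sk eqxx.
- by move=> S /negbTE Sk; rewrite prob_light_clique Sk.
rewrite -/(lambda k n w).
rewrite (sum_cliques (c := \sum_(2 <= l < k.+1)
  (nb_overlap k n l)%:R * clique_prob k w ^+ 2)); last 2 first.
- move=> S Sk; rewrite -(sum_overlap (fun=> _) Sk) big_mkcond [RHS]big_mkcond.
  apply: eq_bigr => S' _; rewrite !prob_light_clique inE Sk eqxx.
  have [S'k|] := eqVneq #|S'| k; last by rewrite mulr0 if_same.
  have [->|] := eqVneq S' S; last by [].
  (* The clique itself is the overlap [l = k], which [b1] includes; it passes the test [1 < l]
     because [k >= 2]. *)
  by rewrite finset.setIid Sk k2.
- move=> S /negbTE Sk; apply: big1 => S' _.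
  by rewrite prob_light_clique Sk mul0r.
rewrite -/(b1 k n w).
rewrite (sum_cliques (c := \sum_(2 <= l < k)
  (nb_overlap k n l)%:R * pair_bound l)); last 2 first.
- move=> S Sk.
  (* The pair with [S' = S] is excluded here, and it is the only one with overlap [k]. Giving
     overlap [k] the value 0 lets [sum_overlap] apply; the last term is dropped afterwards. *)
  transitivity (\sum_(2 <= l < k.+1)
      (nb_overlap k n l)%:R * (if l == k then 0 else pair_bound l)).
    rewrite -(sum_overlap (fun l => if l == k then 0 else pair_bound l) Sk).
    rewrite big_mkcond [RHS]big_mkcond; apply: eq_bigr => S' _.
    have [S'k|S'k] := eqVneq #|S'| k; last first.
      by rewrite (light_clique0 S'k) setI0 measure0 if_same.
    rewrite inE; have [->|S'S] := eqVneq S' S.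
      by rewrite finset.setIid Sk eqxx if_same.
    rewrite /= andbT; case: ifP => // _.
    rewrite prob_light_clique2// ifF//; apply: contra_neqF S'S => /eqP S'Sk.
    (* Two sets of size [k] with [k] common elements coincide. *)
    have : (S' :&: S == S')%SET by rewrite eqEcard finset.subsetIl S'Sk S'k/=.
    move=> /eqP/finset.setIidPl S'subS.
    by apply/eqP; rewrite eqEcard S'subS Sk S'k/=.
  rewrite big_nat_recr//= eqxx mulr0 addr0; apply: eq_big_nat => l /andP[_ lk].
  by rewrite ltn_eqF.
- move=> S Sk; apply: big1 => S' _.
  by rewrite (light_clique0 Sk) set0I measure0.
rewrite /b2 /pair_bound; under eq_bigr do rewrite mulrA.
by apply => S; rewrite inE eqxx.
Qed.

Lemma min_clique_weight_geE :
  [set t | (w%:E <= min_clique_weight k X t)%E] =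
  ~` \bigcup_S light_clique S.
Proof.
apply/seteqP; split=> [t /= wt [S _ [Sk]]|t /= tS].
  apply/negP; rewrite -leNgt -lee_fin (le_trans wt)//.
  by apply: bigmin_le_cond; rewrite Sk.
apply: le_bigmin => [|S /eqP Sk]; first exact: leey.
by rewrite lee_fin leNgt; apply/negP => Sw; apply: tS; exists S.
Qed.

End CliqueEvents.

Unset Implicit Arguments.
Set Strict Implicit.

Theorem theorem3 (R : realType) (k : nat) (hk : (3 <= k)%N)
    (z : R) (hz : 0 <= z) :
  (0 < z ->
    (fun n : nat => lambda k n (threshold k n z) /
       (z ^+ 'C(k, 2) / ((k`!)%:R * ('C(k, 2)`!)%:R))) @ \oo --> (1 : R)) /\
  forall (n : nat) (hn : (k <= n)%N),
    (z <= n%:R `^ (2 / (k - 1)%:R) <-> threshold k n z <= 1) /\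
    forall (d : measure_display) (T : measurableType d) (P : probability T R)
      (X : edge n -> {RV P >-> R}),
      mutually_independent X -> (forall e, uniform01 (X e)) ->
      z <= n%:R `^ (2 / (k - 1)%:R) ->
      (`| P [set t | (threshold k n z)%:E <= min_clique_weight k X t]
          - (expR (- lambda k n (threshold k n z)))%:E |
       <= (b1 k n (threshold k n z) + b2 k n (threshold k n z))%:E)%E.
Proof.
have k1 : (1 < k)%N by exact: leq_trans hk.
split=> [z0|n kn]; first exact: lambda_cvg.
have n0 : (0 < n)%N by apply: leq_trans kn; exact: ltnW.
have npow_gt0 : 0 < n%:R `^ (2 / (k - 1)%:R) :> R by rewrite powR_gt0// ltr0n.
have w1E : z <= n%:R `^ (2 / (k - 1)%:R) <-> threshold k n z <= 1.
  by rewrite /threshold ler_pdivrMr// mul1r.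
split=> // d T P X X_indep X_unif /w1E w1.
have w01 : 0 <= threshold k n z <= 1 by rewrite w1 divr_ge0// ltW.
rewrite min_clique_weight_geE -(@fineK _ (P _)); last first.
  apply/fin_num_measure/measurableC; apply: fin_bigcup_measurable => [|S _].
    exact: finite_finset.
  exact: measurable_light_clique.
rewrite -EFinB lee_fin.
exact: clique_poisson_approximation k1 w01 X_indep X_unif.
Qed.
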